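(* Let $G$ be a finite $2$-group. The following are equivalent: (1) $\Delta(G)$ is triangle-free; (2) $G$ has exponent at most $4$ and every element of $G$ of order $4$ is conjugate to its inverse; (3) $G$ has exponent at most $4$ and $G$ is a real group. In particular, if $G$ is a finite $2$-group and $\Delta(G)$ is triangle-free, then the center $Z(G)$ is elementary abelian.
   Context: All groups are finite. For a group $G$, the cyclic conjugacy class graph $\Delta(G)$ is the simple undirected graph whose vertices are the nontrivial conjugacy classes of $G$ (the classes $x^G$ with $1\ne x\in G$), where two distinct vertices $x^G$ and $y^G$ are adjacent when there exist $x'\in x^G$ and $y'\in y^G$ such that the subgroup $\langle x',y'\rangle$ is cyclic. A graph is triangle-free if it does not contain three distinct pairwise adjacent vertices. An element $g\in G$ is real if $g$ is conjugate in $G$ to $g^{-1}$; $G$ is a real group if all of its elements are real. *)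

(* Defs.v *)
From mathcomp Require Import all_boot all_fingroup all_solvable.

Set Implicit Arguments.
Unset Strict Implicit.
Unset Printing Implicit Defensive.

Local Open Scope group_scope.

Section SimpleGraph.

Variable T : finType.

(* A simple undirected graph whose vertices form a subset of T; sg_adj is only
   meaningful on sg_vert. *)
Record sgraph := SGraph {
  sg_vert : {set T};
  sg_adj : rel T;
  sg_sym : symmetric sg_adj;
  sg_irrefl : irreflexive sg_adj }.

Definition triangle_free (D : sgraph) : Prop :=
  ~ exists a b c : T,
      [/\ a \in sg_vert D, b \in sg_vert D & c \in sg_vert D] /\
      [/\ a != b, a != c & b != c] /\
      [/\ sg_adj D a b, sg_adj D a c & sg_adj D b c].

End SimpleGraph.

Section ClassGraph.

Variable gT : finGroupType.
Implicit Types (G : {group gT}) (A B : {set gT}).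

Definition ccc_adj : rel {set gT} := fun A B =>
  (A != B) && [exists x in A, exists y in B, cyclic <<[set x; y]>>].

Lemma ccc_adj_sym : symmetric ccc_adj.
Proof.
have half A B : ccc_adj A B -> ccc_adj B A.
  case/andP=> neqAB /exists_inP[x Ax /exists_inP[y By cyc_xy]].
  rewrite /ccc_adj eq_sym neqAB; apply/exists_inP; exists y => //.
  by apply/exists_inP; exists x; rewrite // setUC.
by move=> A B; apply/idP/idP; apply: half.
Qed.

Lemma ccc_adj_irrefl : irreflexive ccc_adj.
Proof. by move=> A; rewrite /ccc_adj eqxx. Qed.

Definition ccc_graph G : sgraph {set gT} :=
  SGraph [set x ^: G | x in G^#] ccc_adj_sym ccc_adj_irrefl.

Definition real_element G (g : gT) : bool := g^-1 \in g ^: G.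

Definition real_group G : Prop := forall g, g \in G -> real_element G g.

End ClassGraph.

(* Main.v *)
(** In a 2-group of exponent at most 4 whose elements are real, adjacent
classes have distinct element orders: two elements of the same order in a
cyclic group generate the same subgroup, so here they are equal or mutually
inverse, hence conjugate. As only the orders 2 and 4 occur, there is no
triangle. Conversely, the classes of x, x^2, x^4 (if x has order at least 8) or
of x, x^-1, x^2 (if x has order 4 and is not real) form a triangle. *)
Require Import Defs.
From mathcomp Require Import all_boot all_fingroup all_solvable.

Local Open Scope group_scope.

Lemma order_class_eq (gT : finGroupType) (G : {group gT}) (x y : gT) :
  x ^: G = y ^: G -> #[x] = #[y].
Proof.
by move=> eq_xy; have := class_refl G x; rewrite eq_xy => /imsetP[g _ ->];
  apply: orderJ.
Qed.

Lemma order_2group_exponent4 (gT : finGroupType) (G : {group gT}) (x : gT) :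
  2.-group G -> (exponent G <= 4)%N -> x \in G ->
  [\/ x = 1, #[x] = 2%N | #[x] = 4%N].
Proof.
move=> pG exp4 Gx.
have le4 : (#[x] <= 4)%N.
  by apply: leq_trans exp4; rewrite dvdn_leq ?exponent_gt0 ?dvdn_exponent.
have /p_natP[n ox] := mem_p_elt pG Gx.
move: le4; rewrite ox; case: n ox => [|[|[|n]]] ox.
- by move=> _; constructor 1; apply/eqP; rewrite -order_eq1 ox.
- by constructor 2.
- by constructor 3.
- by rewrite -[4%N]/(2 ^ 2)%N leq_exp2l.
Qed.

(** A cyclic group has at most one subgroup of each order, so [y] is a generator [x ^+ i] of
    [<[x]>]. Then [i] is coprime to 2 or 4, which leaves [i = 1], or [i = 3] when the order is 4. *)
Lemma cyclic_same_order4 (gT : finGroupType) (x y : gT) :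
  #[x] = 2%N \/ #[x] = 4%N -> #[x] = #[y] -> cyclic <<[set x; y]>> ->
  y = x \/ y = x^-1.
Proof.
move=> ox oxy cyc.
have sx : <[x]> \subset <<[set x; y]>> by rewrite cycle_subG mem_gen ?set21.
have sy : <[y]> \subset <<[set x; y]>> by rewrite cycle_subG mem_gen ?set22.
have /eqP eqC : <[y]> == <[x]> :> {set gT}.
  by rewrite (eq_subG_cyclic cyc) // -!orderE oxy.
have [i lti yE] : exists2 i, (i < #[x])%N & y = x ^+ i.
  by have /cyclePmin[i lti ->] : y \in <[x]>; [rewrite -eqC cycle_id | exists i].
have coi : coprime #[x] i.
  by rewrite -generator_coprime /generator -yE eqC.
case: ox => ox; rewrite ox in lti coi.
  by left; move: yE; case: i lti coi => [|[|i]] //; rewrite expg1.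
move: yE; case: i lti coi => [|[|[|[|i]]]] // _ _ ->; first by left.
by right; apply/esym/eqP; rewrite eq_invg_mul -expgS -ox expg_order.
Qed.

Lemma ccc_adj_order_neq (gT : finGroupType) (G : {group gT}) (x y : gT) :
    2.-group G -> (exponent G <= 4)%N -> real_group G ->
    x \in G^# -> y \in G^# -> ccc_adj (x ^: G) (y ^: G) ->
  #[x] != #[y].
Proof.
move=> pG exp4 realG /setD1P[nt_x Gx] _.
case/andP=> neq /exists_inP[_ /imsetP[g Gg ->]].
case/exists_inP=> _ /imsetP[h Gh ->] cyc.
apply: contra neq => /eqP oxy.
have ox : #[x ^ g] = 2%N \/ #[x ^ g] = 4%N.
  rewrite orderJ; have [x1||] := order_2group_exponent4 _ _ _ pG exp4 Gx.
  - by rewrite x1 eqxx in nt_x.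
  - by left.
  - by right.
(* The classes may be represented by the conjugates [x ^ g] and [y ^ h], which together generate a
   cyclic group. *)
rewrite -(classGidl x Gg) -(classGidl y Gh).
have [| -> | ->] := cyclic_same_order4 _ _ _ ox _ cyc; rewrite ?orderJ //.
by rewrite eq_sym; apply/eqP/class_eqP/realG; rewrite groupJ.
Qed.

Lemma ccc_adj_cycle (gT : finGroupType) (G : {group gT}) (z x y : gT) :
  x \in <[z]> -> y \in <[z]> -> x ^: G != y ^: G ->
  ccc_adj (x ^: G) (y ^: G).
Proof.
move=> zx zy neq; apply/andP; split=> //.
apply/exists_inP; exists x; first exact: class_refl.
apply/exists_inP; exists y; first exact: class_refl.
apply: cyclicS (cycle_cyclic z).
by rewrite gen_subG; apply/subsetP=> u /set2P[] ->.
Qed.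

(** Any two elements of [<[x]>] generate a cyclic group, so three distinct nontrivial classes
    meeting [<[x]>] form a triangle. Both a large exponent and a non-real element of order 4 are
    excluded in this way. *)
Lemma cycle_triangle (gT : finGroupType) (G : {group gT}) (x y z : gT) :
    triangle_free (ccc_graph G) -> x \in G -> y \in <[x]> -> z \in <[x]> ->
    y != 1 -> z != 1 ->
    x ^: G != y ^: G -> x ^: G != z ^: G -> y ^: G != z ^: G ->
  False.
Proof.
move=> tfG Gx xy xz nt_y nt_z nxy nxz nyz; apply: tfG.
have sxG : <[x]> \subset G by rewrite cycle_subG.
have nt_x : x != 1.
  by apply: contra nt_y => /eqP x1; move: xy; rewrite x1 cycle1 inE.
have xx := cycle_id x.
exists (x ^: G), (y ^: G), (z ^: G); split; last split=> //.
  by split; apply: imset_f; rewrite !inE ?nt_x ?nt_y ?nt_z ?(subsetP sxG).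
by split; apply: (@ccc_adj_cycle _ _ x).
Qed.

Lemma triangle_free_exponent (gT : finGroupType) (G : {group gT}) :
  2.-group G -> triangle_free (ccc_graph G) -> (exponent G <= 4)%N.
Proof.
(* Since [G] is nilpotent, its exponent is the order of some element [x]. *)
move=> pG tfG; have [x Gx ->] := exponent_witness (pgroup_nil pG).
have /p_natP[n ox] := mem_p_elt pG Gx.
(* Beyond the orders 1, 2 and 4, [x] has order [2 ^ n.+3], so [x], [x ^+ 2] and [x ^+ 4] are
   nontrivial of distinct orders. *)
case: n ox => [|[|[|n]]] ox; [by rewrite ox.. |].
have ox2 : #[x ^+ 2] = (2 ^ n.+2)%N.
  by rewrite (orderXexp 1 ox) subn1.
have ox4 : #[x ^+ 4] = (2 ^ n.+1)%N by rewrite (orderXexp 2 ox) subn2.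
have neq_order (u v : gT) : #[u] != #[v] -> u ^: G != v ^: G.
  by apply: contra => /eqP/order_class_eq->.
case: (@cycle_triangle _ G x (x ^+ 2) (x ^+ 4)) => //; rewrite ?mem_cycle //;
  do ?[apply: neq_order]; rewrite -?order_eq1 ?ox ?ox2 ?ox4 ?eqn_exp2l //.
1,2: by rewrite -[1%N](expn0 2) eqn_exp2l.
all: by rewrite !eqSS gtn_eqF.
Qed.

Lemma triangle_free_real4 (gT : finGroupType) (G : {group gT}) (x : gT) :
  triangle_free (ccc_graph G) -> x \in G -> #[x] = 4%N -> x^-1 \in x ^: G.
Proof.
move=> tfG Gx ox; apply/negPn/negP=> nreal.
have ox2 : #[x ^+ 2] = 2%N by rewrite orderXdiv ox.
case: (@cycle_triangle _ G x x^-1 (x ^+ 2)) => //;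
  rewrite ?groupV ?cycle_id ?mem_cycle // -?order_eq1 ?orderV ?ox ?ox2 //.
(* [x] and [x^-1] have the same order; it is non-reality that separates their classes. *)
- by apply: contra nreal => /eqP->; apply: class_refl.
- by apply/eqP => /order_class_eq; rewrite ox ox2.
- by apply/eqP => /order_class_eq; rewrite orderV ox ox2.
Qed.

(** Elements of order 1 or 2 are their own inverses, so only order 4 needs the hypothesis. *)
Lemma real_group_exponent4 (gT : finGroupType) (G : {group gT}) :
    2.-group G -> (exponent G <= 4)%N ->
    (forall g : gT, g \in G -> #[g] = 4%N -> g^-1 \in g ^: G) ->
  real_group G.
Proof.
move=> pG exp4 real4 g Gg; rewrite /real_element.
have [->|og|] := order_2group_exponent4 _ _ _ pG exp4 Gg.
- by rewrite invg1 class_refl.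
- suff -> : g^-1 = g by apply: class_refl.
  by apply/eqP; rewrite eq_invg_mul -expg2 -og expg_order.
- exact: real4.
Qed.

Lemma real_group_triangle_free (gT : finGroupType) (G : {group gT}) :
  2.-group G -> (exponent G <= 4)%N -> real_group G ->
  triangle_free (ccc_graph G).
Proof.
move=> pG exp4 realG [A [B [C [[]]]]].
move=> /imsetP[x Gx ->{A}] /imsetP[y Gy ->{B}] /imsetP[z Gz ->{C}].
move=> [_ [axy axz ayz]].
have neq := ccc_adj_order_neq _ G _ _ pG exp4 realG.
have order24 (u : gT) : u \in G^# -> #[u] = 2%N \/ #[u] = 4%N.
  case/setD1P=> nt_u Gu.
  have [u1||] := order_2group_exponent4 _ _ _ pG exp4 Gu; [|by left|by right].
  by rewrite u1 eqxx in nt_u.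
have := neq _ _ Gx Gy axy; have := neq _ _ Gx Gz axz.
have := neq _ _ Gy Gz ayz.
(* Three pairwise distinct orders cannot all lie in {2, 4}. *)
by case: (order24 x Gx) (order24 y Gy) (order24 z Gz) => -> [] -> [] ->.
Qed.

(** A central element is its only conjugate, so being real forces it to equal its inverse. *)
Lemma real_group_center_abelem (gT : finGroupType) (G : {group gT}) :
  real_group G -> 2.-abelem 'Z(G).
Proof.
move=> realG; apply/abelemP=> //; split=> [|z Zz]; first exact: center_abelian.
have [Gz cGz] := setIP Zz.
have /imsetP[g Gg zV] := realG z Gz.
apply/eqP; rewrite expgS expg1 -eq_invg_mul zV; apply/eqP.
by apply/conjg_fixP/commgP; apply: (centP cGz).
Qed.

Theorem theorem3p2 (gT : finGroupType) (G : {group gT}) (pG : 2.-group G) :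
  [<-> triangle_free (ccc_graph G);
       (exponent G <= 4)%N /\
         (forall g : gT, g \in G -> #[g] = 4%N -> g^-1 \in g ^: G);
       (exponent G <= 4)%N /\ real_group G]
  /\ (triangle_free (ccc_graph G) -> 2.-abelem 'Z(G)).
Proof.
have tf_real4 : triangle_free (ccc_graph G) -> (exponent G <= 4)%N /\
    (forall g : gT, g \in G -> #[g] = 4%N -> g^-1 \in g ^: G).
  move=> tfG; split; first exact: triangle_free_exponent.
  by move=> g; apply: triangle_free_real4.
split; last first.
  move=> /tf_real4[exp4 real4].
  exact/real_group_center_abelem/real_group_exponent4.
tfae=> [|[exp4 real4]|[exp4 realG]]; first exact: tf_real4.
  by split=> //; apply: real_group_exponent4.
exact: real_group_triangle_free.
Qed.
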